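(* For $\mathbf{x} = \{x_0, x_1\}$, let $\Phi$ be the endomorphism of the free group $F(\mathbf{x})$ defined by $x_i \mapsto x_i^2 x_{i+1}^{-1}$ for $i = 0, 1$ (subscripts modulo $2$). For $a \ge 0$ let $\hat{G}_a$ be the group presented by $\langle \mathbf{x} : \Phi^a(\mathbf{x}) \rangle$. Then for every $a > 0$ the group $\hat{G}_a$ is cyclic of order $3^a$, and its normal subgroups $N_k = \langle \Phi^{a-k}(\mathbf{x}) \rangle \cong \hat{G}_k$, $0 \le k \le a$, form a composition series with $N_k / N_{k-1} \cong \mathbb{Z}_3$ for $0 < k \le a$.
   Context: $\Phi^a(\mathbf{x}) = \{\Phi^a(x_0), \Phi^a(x_1)\}$, with $\Phi^0$ the identity. $N_k$ denotes the subgroup of $\hat{G}_a$ generated by the images of $\Phi^{a-k}(x_0)$ and $\Phi^{a-k}(x_1)$. *)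

(* Defs.v *)
From HB Require Import structures.
From mathcomp Require Import all_boot all_order all_algebra all_fingroup.
From mathcomp Require Import generic_quotient.
From mathcomp Require Import all_classical.

Set Implicit Arguments.
Unset Strict Implicit.
Unset Printing Implicit Defensive.

Local Open Scope classical_set_scope.
Local Open Scope quotient_scope.
Local Open Scope group_scope.

(* The letter (i, false) stands for x_i and (i, true) for x_i^-1; a free group
   element is a word without two adjacent mutually inverse letters. *)
Section FreeGroup.
Variable X : choiceType.

Local Notation letter := (X * bool)%type.

Definition linv (l : letter) : letter := (l.1, ~~ l.2).

Definition reduced (w : seq letter) : bool :=
  sorted (fun l l' => l' != linv l) w.

(* The reduced form of l :: w, when w is reduced. *)
Definition push (l : letter) (w : seq letter) : seq letter :=
  if w is l' :: w' then (if l' == linv l then w' else l :: w) else [:: l].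

Record free_group : Type := FreeGroup {
  word_of :> seq letter;
  word_ofP : reduced word_of
}.

HB.instance Definition _ := [isSub for word_of].
HB.instance Definition _ := [Choice of free_group by <:].

Lemma linvK : involutive linv.
Proof. by case=> x b; rewrite /linv /= negbK. Qed.

Lemma reduced_push l w : reduced w -> reduced (push l w).
Proof.
case: w => [|l' w] //= rw; case: ifPn => [_|nl]; first exact: path_sorted rw.
by rewrite /= nl.
Qed.

Lemma pushK l w : reduced w -> push l (push (linv l) w) = w.
Proof.
case: w => [|l' w] /=; first by rewrite eqxx.
rewrite linvK; case: eqP => [->|_] rw /=; last by rewrite eqxx.
by case: w rw => [|l'' w] //= /andP[/negPf ->].
Qed.

Lemma reduced_foldr u v : reduced v -> reduced (foldr push v u).
Proof. by move=> rv; elim: u => //= l u IH; apply: reduced_push. Qed.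

Lemma foldr_reduced u : reduced u -> foldr push [::] u = u.
Proof.
elim: u => //= l u IH ru; rewrite IH; last exact: path_sorted ru.
by case: u ru {IH} => //= l' u /andP[/negPf ->].
Qed.

Lemma foldr_push l u v : reduced u -> reduced v ->
  foldr push v (push l u) = push l (foldr push v u).
Proof.
case: u => [|l' u] //= ru rv; case: eqP => [->|//].
by rewrite pushK // reduced_foldr.
Qed.

Definition fg_mul (u v : free_group) : free_group :=
  FreeGroup (reduced_foldr u (word_ofP v)).

Definition fg_one : free_group := @FreeGroup [::] isT.

Lemma reduced_inv u : reduced u -> reduced (rev (map linv u)).
Proof.
move=> ru; rewrite /reduced rev_sorted sorted_map; apply: sub_sorted ru.
by move=> l l' /=; rewrite linvK eq_sym.
Qed.

Definition fg_inv (u : free_group) : free_group :=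
  FreeGroup (reduced_inv (word_ofP u)).

Lemma fg_mulA : associative fg_mul.
Proof.
move=> u v w; apply: val_inj => /=; elim: (word_of u) => //= l s ->.
by rewrite foldr_push ?word_ofP // reduced_foldr // word_ofP.
Qed.

Lemma fg_mul1 : left_id fg_one fg_mul.
Proof. by move=> u; apply: val_inj. Qed.

Lemma fg_mulr1 : right_id fg_one fg_mul.
Proof. by move=> u; apply: val_inj; apply: foldr_reduced (word_ofP u). Qed.

Lemma fg_mulV : left_inverse fg_one fg_inv fg_mul.
Proof.
move=> u; apply: val_inj => /=; have := word_ofP u.
elim: (word_of u) => //= l s IH rs; rewrite rev_cons foldr_rcons.
rewrite /push linvK eqxx; apply: IH; exact: path_sorted rs.
Qed.

Lemma fg_mulrV : right_inverse fg_one fg_inv fg_mul.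
Proof.
have fg_invK : involutive fg_inv.
  move=> u; apply: val_inj => /=.
  by rewrite map_rev revK -map_comp map_id_in // => l _; apply: linvK.
by move=> u; rewrite -{1}(fg_invK u) fg_mulV.
Qed.

HB.instance Definition _ :=
  isGroup.Build free_group fg_mulA fg_mul1 fg_mulr1 fg_mulV fg_mulrV.

Definition fgen (x : X) : free_group := @FreeGroup [:: (x, false)] isT.

Section Lift.
Variables (G : groupType) (f : X -> G).

Definition letter_val (l : letter) : G := if l.2 then (f l.1)^-1 else f l.1.

Definition free_lift (u : free_group) : G :=
  foldr (fun l g => letter_val l * g) 1 (word_of u).

Lemma letter_valV l : letter_val (linv l) = (letter_val l)^-1.
Proof. by case: l => x [] //=; rewrite /letter_val /= invgK. Qed.

Lemma free_liftM : {morph free_lift : u v / u * v}.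
Proof.
move=> u v; rewrite /free_lift /=; elim: (word_of u) => /= [|l s IH].
  by rewrite mul1g.
rewrite -mulgA -IH; case: (foldr push v s) => //= l' t.
by case: eqP => [->|//]; rewrite letter_valV mulKVg.
Qed.

HB.instance Definition _ :=
  isUMagmaMorphism.Build _ _ free_lift (erefl, free_liftM).

Lemma free_lift_gen x : free_lift (fgen x) = f x.
Proof. by rewrite /free_lift /= mulg1. Qed.

End Lift.

Lemma free_lift_uniq (G : groupType) (f : X -> G) (h : free_group -> G) :
  {morph h : u v / u * v} -> (forall x, h (fgen x) = f x) ->
  h =1 free_lift f.
Proof.
move=> hM hgen [w rw].
have h1 : h 1 = 1 by apply: (@mulgI _ (h 1)); rewrite -hM !mulg1.
have hV u : h u^-1 = (h u)^-1.
  by apply: (@mulgI _ (h u)); rewrite -hM !mulgV.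
elim: w rw => [|[x b] w IH] rw.
  by rewrite /free_lift /= -h1; congr h; apply: val_inj.
have rw' : reduced w by exact: path_sorted rw.
pose g : free_group := if b then (fgen x)^-1 else fgen x.
have -> : FreeGroup rw = g * FreeGroup rw'.
  apply: val_inj; rewrite /g; case: (b) rw => /= rw;
  by case: (w) rw => //= l' s /andP[/negPf ->].
rewrite hM free_liftM IH; congr (_ * _).
by rewrite /g; case: (b); rewrite ?hV ?hgen /free_lift /= mulg1.
Qed.

End FreeGroup.

Arguments free_group X : clear implicits.

Section Subgroups.
Variable G : groupType.

Definition is_subgroup (A : set G) : Prop := group_closed (mem A).

Record subgroup : Type := Subgroup {
  subgroup_set :> set G;
  subgroupP : is_subgroup subgroup_set
}.

Definition is_normal (A : set G) : Prop := forall x y, A x -> A (x ^ y).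

Lemma is_subgroupE (A : set G) :
  is_subgroup A <-> A 1 /\ (forall x y, A x -> A y -> A (x * y^-1)).
Proof.
split=> [[A1 AF]|[A1 AF]].
  split=> [|x y /mem_set Ax /mem_set Ay]; first exact/set_mem.
  by apply/set_mem; apply: AF.
split=> [|x y /set_mem Ax /set_mem Ay]; first exact/mem_set.
by apply/mem_set; apply: AF.
Qed.

Lemma smallest_subgroup (C : set (set G)) (A : set G) :
  (forall B, C B -> is_subgroup B) -> is_subgroup (smallest C A).
Proof.
move=> Csub; apply/is_subgroupE; split=> [B [CB _]|x y Ax Ay B [CB AB]].
  by have /is_subgroupE[B1 _] := Csub _ CB; apply: B1.
by have /is_subgroupE[_ BF] := Csub _ CB; apply: BF; [apply: Ax|apply: Ay].
Qed.

Definition generated_subgroup (A : set G) : subgroup :=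
  Subgroup (@smallest_subgroup is_subgroup A (fun B CB => CB)).

Definition normal_closure (A : set G) : subgroup :=
  Subgroup (@smallest_subgroup [set B | is_subgroup B /\ is_normal B] A
              (fun B CB => proj1 CB)).

Lemma normal_closure_normal (A : set G) : is_normal (normal_closure A).
Proof.
move=> x y Ax B CB; have [[_ nB] _] := CB; exact: (nB x y (Ax B CB)).
Qed.

Definition subgroup_type (H : subgroup) : Type := {x : G | x \in (H : set G)}.

Section Subg.
Variable H : subgroup.
HB.instance Definition _ := SubChoice.on (subgroup_type H).
HB.instance Definition _ :=
  SubChoice_isSubGroup.Build G (mem (H : set G)) (subgroup_type H) (subgroupP H).
End Subg.

(* Left cosets of H; the group operations need H to be normal. *)
Section Quotient.
Variable H : subgroup.
Local Notation Hs := (subgroup_set H).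

Definition coset_rel (x y : G) : bool := (x^-1 * y) \in (H : set G).

Let H1 : Hs 1. Proof. by case/is_subgroupE: (subgroupP H). Qed.
Let HF x y : Hs x -> Hs y -> Hs (x * y^-1).
Proof. by case/is_subgroupE: (subgroupP H) => _; apply. Qed.
Let HV x : Hs x -> Hs x^-1.
Proof. by move=> Hx; rewrite -(mul1g x^-1); apply: HF. Qed.
Let HM x y : Hs x -> Hs y -> Hs (x * y).
Proof. by move=> Hx /HV Hy; rewrite -(invgK y); apply: HF. Qed.

Lemma coset_relP x y : reflect (Hs (x^-1 * y)) (coset_rel x y).
Proof. by apply: (iffP idP) => [/set_mem|/mem_set]. Qed.

Lemma coset_rel_refl : reflexive coset_rel.
Proof. by move=> x; apply/coset_relP; rewrite mulVg. Qed.

Lemma coset_rel_sym : symmetric coset_rel.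
Proof.
move=> x y; apply/coset_relP/coset_relP => /HV;
by rewrite invgM invgK.
Qed.

Lemma coset_rel_trans : transitive coset_rel.
Proof.
move=> y x z /coset_relP xy /coset_relP yz; apply/coset_relP.
by have := HM xy yz; rewrite mulgA mulgK.
Qed.

Canonical coset_equiv :=
  EquivRel coset_rel coset_rel_refl coset_rel_sym coset_rel_trans.

Definition quot_group (nH : is_normal H) : Type := {eq_quot coset_rel}.

Variable nH : is_normal H.
Local Notation Q := (quot_group nH).

HB.instance Definition _ := Choice.on Q.
HB.instance Definition _ := EqQuotient.on Q.

Definition quot_one : Q := \pi_Q 1.
Definition quot_mul (x y : Q) : Q := \pi_Q (repr x * repr y).
Definition quot_inv (x : Q) : Q := \pi_Q (repr x)^-1.

Lemma quot_piE (x y : G) : \pi_Q x = \pi_Q y <-> Hs (x^-1 * y).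
Proof.
split=> [e|/coset_relP e]; first by apply/coset_relP/eqmodP.
exact/eqmodP.
Qed.

Lemma quot_reprE (x : G) : Hs (x^-1 * repr (\pi_Q x)).
Proof. by apply/quot_piE; rewrite reprK. Qed.

Lemma quot_piM : {morph \pi_Q : x y / x * y >-> quot_mul x y}.
Proof.
move=> x y; apply/quot_piE.
have -> : (x * y)^-1 * (repr (\pi_Q x) * repr (\pi_Q y)) =
  (x^-1 * repr (\pi_Q x)) ^ y * (y^-1 * repr (\pi_Q y)).
  by rewrite /conjg invgM !mulgA mulgK.
by apply: HM; [apply: nH|]; apply: quot_reprE.
Qed.

Lemma quot_piV : {morph \pi_Q : x / x^-1 >-> quot_inv x}.
Proof.
move=> x; apply/quot_piE; rewrite invgK.
have -> : x * (repr (\pi_Q x))^-1 = ((x^-1 * repr (\pi_Q x)) ^ x^-1)^-1.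
  by rewrite /conjg invgK -!mulgA mulVKg invgM invgK.
by apply: HV; apply: nH; apply: quot_reprE.
Qed.

Lemma quot_mulA : associative quot_mul.
Proof.
move=> x y z; rewrite -(reprK x) -(reprK y) -(reprK z).
by rewrite -!quot_piM !reprK mulgA.
Qed.

Lemma quot_mul1 : left_id quot_one quot_mul.
Proof. by move=> x; rewrite -(reprK x) -quot_piM mul1g. Qed.

Lemma quot_mulr1 : right_id quot_one quot_mul.
Proof. by move=> x; rewrite -(reprK x) -quot_piM mulg1. Qed.

Lemma quot_mulV : left_inverse quot_one quot_inv quot_mul.
Proof. by move=> x; rewrite -(reprK x) -quot_piV -quot_piM mulVg. Qed.

Lemma quot_mulrV : right_inverse quot_one quot_inv quot_mul.
Proof. by move=> x; rewrite -(reprK x) -quot_piV -quot_piM mulgV. Qed.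

HB.instance Definition _ :=
  isGroup.Build Q quot_mulA quot_mul1 quot_mulr1 quot_mulV quot_mulrV.

Definition quot_proj (x : G) : Q := \pi_Q x.

Lemma quot_projM : {morph quot_proj : x y / x * y}.
Proof. exact: quot_piM. Qed.

HB.instance Definition _ :=
  isUMagmaMorphism.Build _ _ quot_proj (erefl, quot_projM).

Lemma quot_projE (x y : G) : quot_proj x = quot_proj y <-> Hs (x^-1 * y).
Proof. exact: quot_piE. Qed.

End Quotient.

Definition cyclic_group : Prop := exists g : G, generated_subgroup [set g] = setT :> set G.

Definition simple_group : Prop :=
  (exists g : G, g != 1) /\
  forall H : subgroup, is_normal H -> H = [set 1] :> set G \/ H = setT :> set G.

End Subgroups.

(* K :&: H as a subgroup of the group H; in use K is contained in H. *)
Section SubgroupIn.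
Variables (G : groupType) (H K : subgroup G).

Definition subgroup_in_set : set (subgroup_type H) := [set x | (K : set G) (val x)].

Lemma subgroup_in_subproof : is_subgroup subgroup_in_set.
Proof.
have /is_subgroupE[K1 KF] := subgroupP K.
by apply/is_subgroupE; split=> [|x y Kx Ky] //=; apply: KF.
Qed.

Definition subgroup_in : subgroup (subgroup_type H) := Subgroup subgroup_in_subproof.
End SubgroupIn.

Definition isomorphic (G H : groupType) : Prop :=
  exists f : G -> H, {morph f : x y / x * y} /\ bijective f.

(* The inclusions are strict because a simple group is nontrivial. *)
Definition composition_series (G : groupType) (n : nat) (N : nat -> subgroup G)
    : Prop :=
  [/\ N 0%N = [set 1] :> set G,
      N n = setT :> set G &
      forall k : nat, (k < n)%N ->
        (N k : set G) `<=` (N k.+1 : set G) /\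
        exists nN : is_normal (subgroup_in (N k.+1) (N k)),
          simple_group (quot_group nN)].

Definition presented_group (X : choiceType) (R : set (free_group X)) : groupType :=
  quot_group (@normal_closure_normal _ R).

Definition presented_proj (X : choiceType) (R : set (free_group X)) :
  free_group X -> presented_group R := quot_proj (@normal_closure_normal _ R).

(* Subscripts live in 'Z_2, so that (i + 1)%R is the successor modulo 2. *)
Definition Phi : free_group 'Z_2 -> free_group 'Z_2 :=
  free_lift (fun i : 'Z_2 => fgen i ^+ 2 * (fgen (i + 1)%R)^-1).

Definition Phi_iter_gens (a : nat) : set (free_group 'Z_2) :=
  [set iter a Phi (fgen i) | i in [set: 'Z_2]].

Definition Ghat (a : nat) : groupType := presented_group (Phi_iter_gens a).

(* Only meaningful for k <= a, as a - k is truncated. *)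
Definition Nsub (a k : nat) : subgroup (Ghat a) :=
  generated_subgroup (presented_proj (Phi_iter_gens a) @` Phi_iter_gens (a - k)).

(* Main.v *)
From HB Require Import structures.
Require Import Defs.
From mathcomp Require Import all_boot all_order all_algebra all_fingroup.
From mathcomp Require Import all_classical.

(** Since Phi(x_0) Phi(x_1) = x_0 (x_0 x_1) x_0^-1, killing both Phi^a(x_0) and
    Phi^a(x_1) kills x_0 x_1.  Hence Ghat a is generated by the image g of x_0,
    that of x_1 is g^-1, and Phi acts on these as cubing: Phi^b(x_0) maps to
    g^(3^b).  So g^(3^a) = 1, and the map to Z/3^a with x_0 |-> 1, x_1 |-> -1
    shows that g has order exactly 3^a.  Everything else is a statement about
    the subgroup of g^(3^(a-k)) in a cyclic group of order 3^a. *)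

Local Open Scope classical_set_scope.

(** * Cyclic groups of prescribed order *)

Section CyclicGroups.
Local Open Scope group_scope.
Implicit Types (G H : groupType) (n : nat).

(* Only natural powers of [g] are used, so [n = 0] is impossible. *)
Definition cyclic_with G (g : G) n : Prop :=
  (forall y : G, exists m, y = g ^+ m) /\ (forall m, g ^+ m = 1 <-> (n %| m)%N).

Lemma cyclic_with_eq {G g n} : @cyclic_with G g n ->
  forall i j, g ^+ i = g ^+ j <-> i = j %[mod n].
Proof.
move=> [_ gn] i j.
wlog le_ij : i j / (i <= j)%N => [hw|].
  case/orP: (leq_total i j) => [/hw //|/hw[ij ji]].
  by split=> /esym => [/ij|/ji] /esym.
have -> : (i = j %[mod n]) <-> (n %| j - i)%N.
  by rewrite -(eqn_mod_dvd _ le_ij); split=> [->|/eqP].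
rewrite -gn -{1}(subnKC le_ij) expgD; split=> [|->]; last by rewrite mulg1.
by rewrite -{1}(mulg1 (g ^+ i)) => /mulgI.
Qed.

Lemma cyclic_with_iso G g H h n :
  @cyclic_with G g n -> @cyclic_with H h n -> isomorphic G H.
Proof.
move=> cG cH; have [gT _] := cG; have [hT _] := cH.
(* [lg] and [lh] are discrete logarithms. They are determined only modulo [n], which suffices
   because powers of [g] and [h] depend only on the exponent modulo [n]. *)
have [lg lgE] := choice gT; have [lh lhE] := choice hT.
have gE := cyclic_with_eq cG; have hE := cyclic_with_eq cH.
exists (fun y => h ^+ lg y); split=> [x y|].
  by rewrite -expgD; apply/hE/gE; rewrite expgD -!lgE.
exists (fun y => g ^+ lh y) => y.
  by rewrite [RHS]lgE; apply/gE/hE; rewrite -lhE.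
by rewrite [RHS]lhE; apply/hE/gE; rewrite -lgE.
Qed.

Lemma cyclic_with_card G g n : (0 < n)%N -> @cyclic_with G g n ->
  ([set: G] #= `I_n)%card.
Proof.
move=> n0 cG; have gE := cyclic_with_eq cG; have [gT _] := cG.
have -> : [set: G] = [set g ^+ i | i in `I_n].
  apply/seteqP; split=> // y _; have [m ->] := gT y.
  by exists (m %% n)%N; [exact: ltn_pmod|apply/gE; rewrite modn_mod].
apply: inj_card_eq => i j /set_mem/= lin /set_mem/= ljn /gE.
by rewrite !modn_small.
Qed.

Lemma subgroup_mul G (K : subgroup G) x y : (K : set G) x -> (K : set G) y -> (K : set G) (x * y).
Proof.
move=> Kx Ky; have /is_subgroupE[K1 KF] := subgroupP K.
by rewrite -(invgK y) -(mul1g y^-1); apply: (KF) => //; apply: KF.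
Qed.

Lemma subgroup_inv G (K : subgroup G) x : (K : set G) x -> (K : set G) x^-1.
Proof.
move=> Kx; have /is_subgroupE[K1 KF] := subgroupP K.
by rewrite -(mul1g x^-1); apply: KF.
Qed.

Lemma subgroup_exp G (K : subgroup G) x n : (K : set G) x -> (K : set G) (x ^+ n).
Proof.
move=> Kx; have /is_subgroupE[K1 _] := subgroupP K.
by elim: n => // n IH; rewrite expgS; apply: subgroup_mul.
Qed.

Lemma cyclic_with_cyclic G g n : @cyclic_with G g n -> cyclic_group G.
Proof.
move=> [gT _]; exists g; apply/seteqP; split=> // y _; have [m ->] := gT y.
by apply: subgroup_exp; apply: sub_gen_smallest.
Qed.

(** A group consisting of powers of one element is abelian, so conjugation fixes every element. *)
Lemma cyclic_with_normal G g n (A : set G) : @cyclic_with G g n -> is_normal A.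
Proof.
move=> [gT _] x y Ax; have [i xE] := gT x; have [j yE] := gT y.
suff -> : x ^ y = x by [].
by rewrite /conjg xE yE -expgD addnC expgD mulKg.
Qed.

Lemma cyclic_with_simple G g p : prime p -> @cyclic_with G g p -> simple_group G.
Proof.
move=> pp cG; have [gT gp] := cG; split=> [|K nK].
  exists g; apply/eqP => g1; have /gp : g ^+ 1 = 1 by rewrite g1.
  by rewrite dvdn1 => /eqP p1; rewrite p1 in pp.
have [K1|] := pselect ((K : set G) `<=` [set 1]).
  left; apply/seteqP; split=> // _ ->.
  by have /is_subgroupE[] := subgroupP K.
move=> /existsNP[y /not_implyP[Ky y1]]; right.
have [m yE] := gT y.
have co : coprime p m.
  by rewrite prime_coprime //; apply/negP => /gp mE; apply: y1; rewrite /= yE.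
(* Bezout gives [p %| 1 + u * m], so [g * y ^+ u = 1]: the nontrivial element [y] of [K] already
   generates [g]. *)
have [u _] := Bezoutl m (prime_gt0 pp).
rewrite (eqP co) => /gp; rewrite expgD expg1 mulnC expgM -yE => gy.
have Kg : (K : set G) g.
  have -> : g = (y ^+ u)^-1 by apply: (mulIg (y ^+ u)); rewrite gy mulVg.
  exact/subgroup_inv/subgroup_exp.
by apply/seteqP; split=> // z _; have [i ->] := gT z; apply: subgroup_exp.
Qed.

(** * Subgroups and quotients of a cyclic group *)

Definition powers {G} (g : G) : set G := [set g ^+ m | m in [set: nat]].

Lemma powers_subgroup G (g : G) n : (0 < n)%N -> g ^+ n = 1 ->
  is_subgroup (powers g).
Proof.
move=> n0 gn; apply/is_subgroupE; split; first by exists 0%N.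
(* Since [g ^+ n = 1], the inverse of [g ^+ j] is the natural power [g ^+ (j * n.-1)]. *)
move=> _ _ [i _ <-] [j _ <-]; exists (i + j * n.-1)%N => //.
rewrite expgD; congr (_ * _); apply: (mulIg (g ^+ j)).
by rewrite mulVg -expgD -mulnSr prednK // mulnC expgM gn expg1n.
Qed.

Lemma subgroup_valX G (K : subgroup G) (x : subgroup_type K) n :
  val (x ^+ n) = val x ^+ n.
Proof. by elim: n => // n IH; rewrite !expgS -IH. Qed.

(** The equation [(g ^+ d) ^+ m = 1] means [d * n %| d * m], and the positive factor [d] cancels. *)
Lemma subgroup_type_cyclic G (g : G) n d (K : subgroup G) :
  (0 < d)%N -> @cyclic_with G g (d * n) -> K = powers (g ^+ d) :> set G ->
  exists2 h : subgroup_type K, val h = g ^+ d & cyclic_with _ h n.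
Proof.
move=> d0 [_ gn] KE.
have Kg : g ^+ d \in (K : set G) by apply/mem_set; rewrite KE; exists 1%N.
exists (exist (fun x => x \in (K : set G)) _ Kg) => //.
split=> [[y Ky]|m].
  have := set_mem Ky; rewrite {1}KE => -[m _ yE]; exists m.
  by apply: val_inj; rewrite subgroup_valX /= yE.
rewrite -(dvdn_pmul2l d0) -gn expgM.
by split=> [/(congr1 val)|e]; [|apply: val_inj]; rewrite subgroup_valX.
Qed.

Lemma quot_group_cyclic G (g : G) n d (K : subgroup G) (nK : is_normal K) :
  @cyclic_with G g (d * n) -> K = powers (g ^+ d) :> set G ->
  cyclic_with (quot_group nK) (quot_proj nK g) d.
Proof.
move=> cG KE; have [gT _] := cG; have gE := cyclic_with_eq cG.
split=> [y|m].
  have [m mE] := gT (generic_quotient.repr y); exists m.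
  rewrite -gmulfXn -mE; exact: esym (generic_quotient.reprK y).
rewrite -gmulfXn -(gmulf1 (s := quot_proj nK)).
split=> [/esym/quot_projE|/dvdnP[q ->]].
  (* Membership of [g ^+ m] in [K] gives [d * i = m] modulo [d * n]; reducing modulo [d] leaves
     [d %| m]. *)
  rewrite invg1 mul1g KE => -[i _]; rewrite -expgM => /gE/(congr1 (modn^~ d)).
  by rewrite !modn_dvdm ?dvdn_mulr // modnMr => /esym/eqP.
by apply/esym/quot_projE; rewrite invg1 mul1g KE mulnC expgM; exists q.
Qed.

(** The carrier is ['I_n.+1] because order 1, needed for [Ghat 0], must be covered, whereas ['Z_1]
    has two elements. *)
Lemma Zp_cyclic n : cyclic_with 'I_n.+1 (inZp 1) n.+1.
Proof.
split=> [y|m].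
  by exists y; rewrite Zp_expg; apply: val_inj; rewrite /= modnMml mul1n modn_small.
rewrite Zp_expg; split=> [/(congr1 val)|mn]; last apply: val_inj.
  by rewrite /= modnMml mul1n => /eqP.
by rewrite /= modnMml mul1n; apply/eqP.
Qed.

End CyclicGroups.

(** * The action of [Phi] seen through homomorphisms *)

Section Ghat.
Local Open Scope group_scope.
Local Notation F := (free_group 'Z_2).
Local Notation x0 := (fgen (0%R : 'Z_2)).
Local Notation x1 := (fgen (1%R : 'Z_2)).

HB.instance Definition _ := UMagmaMorphism.on Phi.

Lemma Phi0 : Phi x0 = x0 ^+ 2 * x1^-1.
Proof. by rewrite /Phi free_lift_gen GRing.add0r. Qed.

Lemma Phi1 : Phi x1 = x1 ^+ 2 * x0^-1.
Proof. by rewrite /Phi free_lift_gen; congr (_ * (fgen _)^-1); apply: val_inj. Qed.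

Lemma Z2P (i : 'Z_2) : i = 0%R \/ i = 1%R.
Proof. by case: i => [[|[|]]] // ?; [left|right]; apply: val_inj. Qed.

(** Induction over all [f]: replacing [f] by [f \o Phi] absorbs one [Phi]. Only the product of the
    two images is carried along, because [Phi] sends [x0 * x1] to a conjugate of itself. *)
Lemma Phi_iter_relators_inv {H : groupType} b (f : UMagmaMorphism.type F H) :
  f (iter b Phi x0) = 1 -> f (iter b Phi x1) = 1 -> f x1 = (f x0)^-1.
Proof.
suff E : f (iter b Phi x0) * f (iter b Phi x1) = 1 -> f x0 * f x1 = 1.
  by move=> e0 e1; apply: (mulgI (f x0)); rewrite mulgV E // e0 e1 mulg1.
elim: b f => //= b IH f /(IH (f \o Phi : UMagmaMorphism.type _ _)) /=.
rewrite Phi0 Phi1 !expg2 !gmulfM !gmulfV => e.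
apply: (mulgI (f x0)); apply: (mulIg (f x0)^-1); rewrite mulg1 mulgV -[RHS]e.
by rewrite !mulgA mulgKV.
Qed.

(** The morphism [f \o Phi] satisfies the same hypothesis, with the cube of [f x0] in place of
    [f x0], so the induction runs over all [f]. *)
Lemma Phi_iter_exp {H : groupType} b (f : UMagmaMorphism.type F H) :
  f x1 = (f x0)^-1 ->
  f (iter b Phi x0) = f x0 ^+ (3 ^ b) /\ f (iter b Phi x1) = f x0 ^- (3 ^ b).
Proof.
elim: b f => [|b IH] f fx1; first by rewrite /= expg1.
have f3 : f (Phi x0) = f x0 ^+ 3.
  by rewrite Phi0 gmulfM gmulfV gmulfXn fx1 invgK -expgSr.
have := IH (f \o Phi : UMagmaMorphism.type _ _); rewrite /= f3 -expgM -expnS.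
apply; rewrite Phi1 gmulfM gmulfV gmulfXn fx1 expVgn.
by rewrite -invgM -expgS.
Qed.

(** * The group [Ghat a] is cyclic of order [3 ^ a] *)

Definition Ghat_gen a : Ghat a := presented_proj (Phi_iter_gens a) x0.

Local Notation proj a := (quot_proj (@normal_closure_normal _ (Phi_iter_gens a))).

Lemma proj_eq1 a u : proj a u = 1 <-> (normal_closure (Phi_iter_gens a) : set F) u.
Proof.
rewrite -(gmulf1 (s := proj a)).
split=> [/esym/quot_projE|nu]; first by rewrite invg1 mul1g.
by apply/esym/quot_projE; rewrite invg1 mul1g.
Qed.

Lemma proj_iter_gen a i : proj a (iter a Phi (fgen i)) = 1.
Proof. by apply/proj_eq1; apply: sub_gen_smallest; exists i. Qed.

Lemma proj_gen1 a : proj a x1 = (Ghat_gen a)^-1.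
Proof. exact: (Phi_iter_relators_inv a (proj a) (proj_iter_gen _ _) (proj_iter_gen _ _)). Qed.

Lemma Ghat_gen_exp a : Ghat_gen a ^+ (3 ^ a) = 1.
Proof.
have [<- _] := Phi_iter_exp a (proj a) (proj_gen1 a).
exact: proj_iter_gen.
Qed.

Lemma kernel_normal_subgroup (G H : groupType) (f : UMagmaMorphism.type G H) :
  is_subgroup [set u | f u = 1] /\ is_normal [set u | f u = 1].
Proof.
split.
  apply/is_subgroupE; split=> [|u v /= fu fv]; first exact: gmulf1.
  by rewrite gmulfM gmulfV fu fv mulgV.
by move=> u v /= fu; rewrite gmulfJ fu conj1g.
Qed.

Lemma Ghat_cyclic a : cyclic_with (Ghat a) (Ghat_gen a) (3 ^ a).
Proof.
have a3 : (0 < 3 ^ a)%N by rewrite expn_gt0.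
split=> [y|m]; last split=> [|/dvdnP[q ->]]; last 1 first.
- by rewrite mulnC expgM Ghat_gen_exp expg1n.
- pose P := Subgroup (powers_subgroup _ _ _ a3 (Ghat_gen_exp a)).
  suff: (P : set _) y by case=> m _ <-; exists m.
  have -> : y = proj a (generic_quotient.repr y).
    exact: esym (generic_quotient.reprK y).
  (* The projection is the lift of its values on the generators, so the image of a word is a product
     over its letters, each of which lands in [P]. *)
  rewrite (free_lift_uniq (quot_projM _) (fun=> erefl)) /free_lift.
  elim: (word_of _) => [|[i b] w IH] /=; first by exists 0%N.
  apply: (@subgroup_mul _ P) => //.
  have Pg : (P : set _) (Ghat_gen a) by exists 1%N.
  have Pi : (P : set _) (proj a (fgen i)).
    case: (Z2P i) => -> //; rewrite proj_gen1; exact: (subgroup_inv _ P).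
  by case: b; rewrite /letter_val //=; apply: (subgroup_inv _ P).
(* The target is written with a successor to fit [Zp_cyclic]; it is the trivial group when
   [a = 0]. *)
pose c : 'I_(3 ^ a).-1.+1 := inZp 1.
pose f := free_lift (fun i : 'Z_2 => if i == 0%R then c else c^-1).
have f0 : f x0 = c by rewrite /f free_lift_gen.
have f1 : f x1 = (f x0)^-1 by rewrite f0 /f free_lift_gen.
have [_ cE] := Zp_cyclic (3 ^ a).-1; rewrite prednK // in cE.
rewrite /Ghat_gen -gmulfXn => /proj_eq1 nm; apply/cE.
have [kS kN] := kernel_normal_subgroup _ _ f.
have fX : f (x0 ^+ m) = c ^+ m by rewrite -f0; exact: (gmulfXn f).
suff: [set u | f u = 1] (x0 ^+ m) by move=> fm; rewrite -fX.
(* The kernel of [f] is a normal subgroup; once it contains the relators it contains their normal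
   closure, and with it [x0 ^+ m]. *)
apply: (nm); split; first by split.
have c1 : c ^+ (3 ^ a) = 1 by apply/cE.
have [e0 e1] : f (iter a Phi x0) = 1 /\ f (iter a Phi x1) = 1.
  rewrite -[X in _ = X /\ _]c1 -[X in _ /\ _ = X]invg1 -c1 -f0.
  exact: (Phi_iter_exp a f f1).
by move=> _ [i _ <-]; case: (Z2P i) => ->.
Qed.

(** * The subgroups [Nsub a k] and their successive quotients *)

Lemma NsubE a k : Nsub a k = powers (Ghat_gen a ^+ (3 ^ (a - k))) :> set _.
Proof.
have [e0 e1] := Phi_iter_exp (a - k) (proj a) (proj_gen1 a).
(* A positive exponent killing the element makes its natural powers a subgroup; [3 ^ a] kills every
   power of the generator. *)
have gk1 : Ghat_gen a ^+ (3 ^ (a - k)) ^+ (3 ^ a) = 1.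
  by rewrite -expgM mulnC expgM Ghat_gen_exp expg1n.
have P := powers_subgroup _ _ _ (expn_gt0 3 a : (0 < 3 ^ a)%N) gk1.
apply/seteqP; split.
  apply: smallest_sub => // _ [_ [i _ <-] <-].
  case: (Z2P i) => ->; first by exists 1%N; rewrite // expg1 -e0.
  rewrite /presented_proj e1; apply: (subgroup_inv _ (Subgroup P)).
  by exists 1%N.
move=> _ [m _ <-]; apply: subgroup_exp; apply: sub_gen_smallest.
by exists (iter (a - k) Phi x0) => //; exists 0%R.
Qed.

Lemma Nsub_cyclic a k : (k <= a)%N ->
  exists2 h : subgroup_type (Nsub a k),
    val h = Ghat_gen a ^+ (3 ^ (a - k)) & cyclic_with _ h (3 ^ k).
Proof.
move=> ka; apply: subgroup_type_cyclic (NsubE a k); first by rewrite expn_gt0.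
(* As [k <= a], the product [3 ^ (a - k) * 3 ^ k] is the full order [3 ^ a]. *)
by rewrite -expnD subnK //; apply: Ghat_cyclic.
Qed.

Lemma Nsub_quot_cyclic a k : (k < a)%N ->
  exists nN : is_normal (subgroup_in (Nsub a k.+1) (Nsub a k)),
  exists g, cyclic_with (quot_group nN) g 3.
Proof.
move=> ka; have [h hE ch] := Nsub_cyclic _ _ ka.
exists (cyclic_with_normal _ _ _ _ ch); exists (quot_proj _ h).
(* The order of [h] splits as [3 * 3 ^ k]; it remains to see that [Nsub a k], inside [Nsub a k.+1],
   consists of the powers of [h ^+ 3]. *)
apply: (quot_group_cyclic _ _ (3 ^ k)); first by rewrite -expnS.
have ak : (3 ^ (a - k) = 3 ^ (a - k.+1) * 3)%N by rewrite -expnSr -subSn.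
have inE y : (subgroup_in (Nsub a k.+1) (Nsub a k) : set _) y =
    powers (Ghat_gen a ^+ (3 ^ (a - k))) (val y) by rewrite -NsubE.
apply/seteqP; split=> [y|_ [m _ <-]]; rewrite inE.
  case=> m _ yE; exists m => //.
  by apply: val_inj; rewrite -yE !subgroup_valX hE ak expgM.
by exists m; rewrite // !subgroup_valX hE ak expgM.
Qed.

End Ghat.

Theorem lemma3p12 (a : nat) (a_gt0 : (0 < a)%N) :
  [/\ cyclic_group (Ghat a) /\ ([set: Ghat a] #= `I_(3 ^ a))%card,
      forall k : nat, (k <= a)%N ->
        is_normal (Nsub a k) /\ isomorphic (subgroup_type (Nsub a k)) (Ghat k),
      composition_series a (Nsub a) &
      forall k : nat, (0 < k <= a)%N ->
        exists nN : is_normal (subgroup_in (Nsub a k) (Nsub a k.-1)),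
          isomorphic (quot_group nN) 'Z_3].
Proof.
have ca := Ghat_cyclic a; have [gT _] := ca.
split.
- split; first exact: cyclic_with_cyclic ca.
  by apply: cyclic_with_card ca; rewrite expn_gt0.
- move=> k ka; split; first exact: cyclic_with_normal ca.
  have [h _ ch] := Nsub_cyclic _ _ ka.
  exact: cyclic_with_iso ch (Ghat_cyclic k).
- split.
  + rewrite NsubE subn0 Ghat_gen_exp; apply/seteqP; split.
      by move=> _ [m _ <-]; rewrite /= expg1n.
    by move=> _ ->; exists 0%N.
  + rewrite NsubE subnn expg1; apply/seteqP; split=> // y _.
    by have [m ->] := gT y; exists m.
  + move=> k ka; split; last first.
      have [nN [g cg]] := Nsub_quot_cyclic _ _ ka.
      by exists nN; apply: cyclic_with_simple cg.
    (* The generator of [Nsub a k] is the cube of that of [Nsub a k.+1], hence the exponent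
       [3 * m]. *)
    rewrite !NsubE => _ [m _ <-]; exists (3 * m)%N => //.
    by rewrite -!expgM mulnA -expnSr -subSn.
- move=> [|k] // /andP[_ ka]; have [nN [g cg]] := Nsub_quot_cyclic _ _ ka.
  (* ['Z_3] is ['I_3], that is ['I_n.+1] with [n = 2]. *)
  by exists nN; apply: cyclic_with_iso cg (Zp_cyclic 2).
Qed.
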